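(* Let $\mathbb{F}$ be a field in which $-3$ is not a square, and let $a,b,c\in\mathbb{F}$. Then any two tangent conics of the affine curve $y^{2}=ax^{3}+bx+c$ over $\mathbb{F}$ (that is, the tangent conics at any two points $[x_0,y_0],[x_1,y_1]\in\mathbb{F}^2$ of the curve) are either identical or disjoint (have no common point in $\mathbb{F}^2$).
   Context: A point is an ordered pair $[x,y]$ of elements of the field $\mathbb{F}$. The tangent conic to an affine curve $f(x,y)=0$, $f\in\mathbb{F}[x,y]$, at a point $A=[x_0,y_0]$ on the curve is defined as the part of the Taylor expansion at $A$ of degree two or less. That is, expand $f(x_0+u,y_0+v)$ as a polynomial in $u,v$, discard all terms of total degree greater than $2$ to obtain a polynomial $q(u,v)$, and translate back: the tangent conic at $A$ is the curve with equation $q(x-x_0,y-y_0)=0$. Here the curve is given by $f(x,y)=y^{2}-(ax^{3}+bx+c)$. *)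

(* Defs.v *)
From mathcomp Require Import all_boot all_order all_algebra.
From mathcomp Require Export mpoly.

Set Implicit Arguments.
Unset Strict Implicit.
Unset Printing Implicit Defensive.

Import GRing.Theory.
Local Open Scope ring_scope.

Section TangentConic.

Variable F : fieldType.

Definition coordX : {mpoly F[2]} := 'X_ord0.
Definition coordY : {mpoly F[2]} := 'X_ord_max.

Definition coords (A : F * F) (i : 'I_2) : F := if i == ord0 then A.1 else A.2.

(* An affine curve is given by its equation f = 0, that is, by f itself; over a
   finite field the equation carries more information than the set of points. *)
Definition on_curve (f : {mpoly F[2]}) (A : F * F) : Prop := f.@[coords A] = 0.

(* f (x + A.1, y + A.2) *)
Definition translate (A : F * F) (f : {mpoly F[2]}) : {mpoly F[2]} :=
  f \mPo [tuple coordX + A.1%:MP; coordY + A.2%:MP].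

Definition truncate (d : nat) (f : {mpoly F[2]}) : {mpoly F[2]} :=
  \sum_(m <- msupp f | (mdeg m <= d)%N) f@_m *: 'X_[m].

Definition tangent_conic (f : {mpoly F[2]}) (A : F * F) : {mpoly F[2]} :=
  translate (- A.1, - A.2) (truncate 2 (translate A f)).

Definition disjoint_curves (f g : {mpoly F[2]}) : Prop :=
  forall P : F * F, ~ (on_curve f P /\ on_curve g P).

Definition cubic_curve (a b c : F) : {mpoly F[2]} :=
  coordY ^+ 2 - (a *: coordX ^+ 3 + b *: coordX + c%:MP).

End TangentConic.

(* Main.v *)
Require Import Defs.
From mathcomp Require Import all_boot all_order all_algebra.
From mathcomp Require Import ring.

Set Implicit Arguments.
Unset Strict Implicit.
Unset Printing Implicit Defensive.

Import GRing.Theory.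
Local Open Scope ring_scope.

(** The cubic curve f = y^2 - (a x^3 + b x + c) has - a u^3 as the only term of
    degree above 2 in its expansion at a point A = (x0, y0), so its tangent
    conic there is f + a (x - x0)^3 ([tangent_conic_cubic_curve]).  A point
    with abscissa x common to the conics at abscissas x0 and x1 therefore
    satisfies a (x - x0)^3 = a (x - x1)^3.  When -3 is not a square, cubing is
    injective ([expr3_inj]), hence a = 0 or x0 = x1; in both cases the two
    conics have the same equation. *)

Section Truncation.

Variable F : fieldType.
Implicit Types p q f : {mpoly F[2]}.

Lemma mcoeff_truncate d f m :
  (truncate d f)@_m = if (mdeg m <= d)%N then f@_m else 0.
Proof.
rewrite /truncate raddf_sum /=.
under eq_bigr do rewrite mcoeffZ mcoeffX.
have [mf|mf] := boolP (m \in msupp f); last first.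
  rewrite (memN_msupp_eq0 mf) if_same big_seq_cond big1 // => k /andP[kf _].
  by case: eqP kf mf => [->->|_ _ _]; rewrite ?mulr0.
rewrite big_mkcond /= (bigD1_seq m) ?msupp_uniq //= eqxx mulr1 big1 ?addr0 //.
by move=> k /negPf ->; rewrite mulr0 if_same.
Qed.

Lemma truncate_add_dhomog d e p q :
  (msize p <= d.+1)%N -> q \is e.-homog -> (d < e)%N -> truncate d (p + q) = p.
Proof.
move=> szp hq lt_de; apply/mpolyP => m; rewrite mcoeff_truncate mcoeffD.
case: leqP => [le_md|lt_dm]; last first.
  by rewrite memN_msupp_eq0 // msize_mdeg_ge // (leq_trans szp).
rewrite (dhomog_nemf_coeff hq) ?addr0 //.
by rewrite neq_ltn (leq_ltn_trans le_md lt_de).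
Qed.

Lemma msize_add_le n p q :
  (msize p <= n)%N -> (msize q <= n)%N -> (msize (p + q) <= n)%N.
Proof. by move=> hp hq; rewrite (leq_trans (msizeD_le _ _)) // geq_max hp. Qed.

End Truncation.

Section CubicCurve.

Variable F : fieldType.
Implicit Types (a b c : F) (A P : F * F).

Local Notation X := (coordX F).
Local Notation Y := (coordY F).

Lemma translate_cubic_curve A a b c :
  translate A (cubic_curve a b c) =
  (Y + A.2%:MP) ^+ 2
  - (a *: (X + A.1%:MP) ^+ 3 + b *: (X + A.1%:MP) + c%:MP).
Proof.
rewrite /translate /cubic_curve !(comp_mpolyB, comp_mpolyD, comp_mpolyZ).
by rewrite comp_mpolyC !rmorphXn /= !comp_mpolyXU.
Qed.

(** The part of degree at most 2 of the expansion of the cubic at [A], grouped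
    by monomials so that its degree can be read off term by term. *)
Definition conic_part A a b c : {mpoly F[2]} :=
  Y ^+ 2 + (A.2 *+ 2) *: Y - (a * A.1 *+ 3) *: X ^+ 2
  - (a * A.1 ^+ 2 *+ 3 + b) *: X
  + (A.2 ^+ 2 - (a * A.1 ^+ 3 + b * A.1 + c))%:MP.

Lemma msize_conic_part A a b c : (msize (conic_part A a b c) <= 3)%N.
Proof.
have szX i : (msize ('X_i : {mpoly F[2]}) <= 3)%N by rewrite msizeX mdeg1.
have szX2 i : (msize ('X_i ^+ 2 : {mpoly F[2]}) <= 3)%N.
  by rewrite mpolyXn msizeX mdegMn mdeg1.
have szZ k (p : {mpoly F[2]}) : (msize p <= 3)%N -> (msize (k *: p) <= 3)%N.
  exact/leq_trans/msizeZ_le.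
rewrite /conic_part /coordX /coordY.
by do !apply: msize_add_le; rewrite ?msizeN ?msizeC ?szZ //; case: (_ != 0).
Qed.

Lemma truncate_translate_cubic_curve A a b c :
  truncate 2 (translate A (cubic_curve a b c)) =
  translate A (cubic_curve a b c) + a *: X ^+ 3.
Proof.
have split3 : translate A (cubic_curve a b c) =
              conic_part A a b c + (- a) *: X ^+ 3.
  rewrite translate_cubic_curve /conic_part.
  rewrite -!mul_mpolyC !(rmorphB, rmorphD, rmorphN, rmorphMn, rmorphM, rmorphXn).
  by rewrite /=; ring.
rewrite [in RHS]split3 scaleNr addrNK split3.
apply: (@truncate_add_dhomog _ _ 3) => //; first exact: msize_conic_part.
by apply: dhomogZ; rewrite /coordX mpolyXn dhomogX /= mdegMn mdeg1.
Qed.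

(** Translating back is a substitution: it restores the equation of the curve
    and turns the correction [a *: X ^+ 3] made by truncation into a cube of
    [X - A.1].  So the conic depends on the abscissa of [A] only. *)
Lemma tangent_conic_cubic_curve A a b c :
  tangent_conic (cubic_curve a b c) A =
  cubic_curve a b c + a *: (X - A.1%:MP) ^+ 3.
Proof.
rewrite /tangent_conic truncate_translate_cubic_curve translate_cubic_curve.
rewrite /translate !(comp_mpolyB, comp_mpolyD, comp_mpolyZ) !rmorphXn /=.
by rewrite !comp_mpolyD !comp_mpolyC !comp_mpolyXU /= !mpolyCN !addrNK.
Qed.

Lemma on_tangent_conic_cubic_curve A P a b c :
  on_curve (tangent_conic (cubic_curve a b c) A) P <->
  (cubic_curve a b c).@[coords P] + a * (P.1 - A.1) ^+ 3 = 0.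
Proof.
rewrite /on_curve tangent_conic_cubic_curve mevalD mevalZ rmorphXn /=.
by rewrite (mevalB _ X) mevalXU mevalC.
Qed.

End CubicCurve.

(** If s^3 = t^3 and s <> t then s^2 + s t + t^2 = 0, that is,
    (2 s + t)^2 = - 3 t^2; this makes -3 a square unless t = 0, and then s = 0
    as well.  The completed square is never divided by 2, so the argument holds
    in characteristic 2 too. *)
Lemma expr3_inj (F : fieldType) :
  ~ (exists z : F, z ^+ 2 = - 3%:R) -> injective (fun s : F => s ^+ 3).
Proof.
move=> h3 s t /eqP; rewrite -subr_eq0 subrXX !big_ord_recr big_ord0 /=.
rewrite mulf_eq0 subr_eq0 => /orP[/eqP //|/eqP st].
have [t0|nz_t] := eqVneq t 0.
  move: st; rewrite t0 !(expr0n, mulr0, mulr1, addr0, add0r) /= => /eqP.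
  by rewrite expf_eq0 => /eqP.
case: h3; exists ((2%:R * s + t) / t).
have sq : (2%:R * s + t) ^+ 2 = - 3%:R * t ^+ 2.
  apply/eqP; rewrite -subr_eq0; apply/eqP.
  by rewrite -[RHS](mulr0 4%:R) -[in RHS]st; ring.
by rewrite expr_div_n sq mulfK // expf_neq0.
Qed.

Theorem theorem5 (F : fieldType)
    (h3 : ~ exists z : F, z ^+ 2 = - 3%:R)
    (a b c : F) (A B : F * F)
    (hA : on_curve (cubic_curve a b c) A)
    (hB : on_curve (cubic_curve a b c) B) :
  tangent_conic (cubic_curve a b c) A = tangent_conic (cubic_curve a b c) B \/
  disjoint_curves (tangent_conic (cubic_curve a b c) A)
                  (tangent_conic (cubic_curve a b c) B).
Proof.
have [a0|nz_a] := eqVneq a 0.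
  by left; rewrite !tangent_conic_cubic_curve a0 !scale0r.
have [AB|neq_AB] := eqVneq A.1 B.1.
  by left; rewrite !tangent_conic_cubic_curve AB.
right=> P [/on_tangent_conic_cubic_curve PA /on_tangent_conic_cubic_curve PB].
move: neq_AB; apply/negP/negPn/eqP.
have /(mulfI nz_a)/(expr3_inj h3) : a * (P.1 - A.1) ^+ 3 = a * (P.1 - B.1) ^+ 3.
  by apply: (addrI (cubic_curve a b c).@[coords P]); rewrite PA PB.
by move/addrI/oppr_inj.
Qed.
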